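(* Let $V^*=V\cup V^{\mathrm{abs}}$ be a finite set and $\{\eta(t),t\ge0\}$ a consistent configuration process on $V^*$ with generator $\mathcal L^{\mathrm{abs}}=\mathcal L+\mathcal H$. Let $\mathbf x=(x_1,\dots,x_n)\in(V^* )^n$. Then for all $m\in\{1,\dots,n-1\}$ and all $\zeta\in\Omega^{\mathrm{abs}}_m$, $$\mathbb E_{\phi(\mathbf x)}[F(\zeta,\eta(\infty))]=\sum_{1\le i_1<\dots<i_m\le n}\mathbb P_{\phi(x_{i_1},\dots,x_{i_m})}\big(\eta(\infty)=\zeta\big).$$
   Context: $V^{\mathrm{abs}}=V^*\setminus V$ is the set of absorbing sites, with rates $r(i,j)\ge0$ for $i\in V$, $j\in V^{\mathrm{abs}}$. $\mathcal L$ is the generator of a configuration process on $V$ (finite configurations with single-site space $\Lambda\subseteq\mathbb N_0$), acting only on $(\eta_i)_{i\in V}$, and $\mathcal Hf(\eta)=\sum_{i\in V,j\in V^{\mathrm{abs}}}r(i,j)\eta_i[f(\eta-\delta_i+\delta_j)-f(\eta)]$. Consistency means $[\mathcal L^{\mathrm{abs}},\mathcal A]=0$ with $\mathcal Af(\eta)=\sum_{x\in V^*}\eta_xf(\eta-\delta_x)$ (terms with $\eta_x=0$ vanish). $\phi(\mathbf y)=\sum_i\delta_{y_i}$. $\Omega^{\mathrm{abs}}_m$ is the set of configurations $\zeta\in\mathbb N_0^{V^{\mathrm{abs}}}$ with $\sum\zeta_j=m$, viewed as configurations on $V^*$ vanishing on $V$. $F(\zeta,\eta)=\prod_{j}\binom{\eta_j}{\zeta_j}$.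 $\mathbb P_\eta(\eta(\infty)=\zeta):=\lim_{t\to\infty}\mathbb P_\eta(\eta(t)=\zeta)$ and $\mathbb E_\eta[f(\eta(\infty))]:=\lim_{t\to\infty}\mathbb E_\eta[f(\eta(t))]$. *)

(* Defs.v *)
From HB Require Import structures.
From mathcomp Require Import all_boot all_order all_algebra.
From mathcomp Require Import all_classical all_reals all_analysis.
Set Implicit Arguments. Unset Strict Implicit. Unset Printing Implicit Defensive.
Import Order.TTheory GRing.Theory Num.Theory.
Import numFieldNormedType.Exports.
Local Open Scope classical_set_scope.
Local Open Scope ring_scope.

(* V* = V + A, where V = bulk sites, A = absorbing sites V^abs.          *)
Section Defs.
Variables (V A : finType).

Definition cfg := {ffun (V + A)%type -> nat}.
Definition cfgV := {ffun V -> nat}.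

Definition mass (eta : cfgV) : nat := (\sum_(i : V) eta i)%N.
Definition massT (eta : cfg) : nat := (\sum_(x : V + A) eta x)%N.

Definition vpart (eta : cfg) : cfgV := [ffun i => eta (inl i)].
Definition replaceV (eta : cfg) (xi : cfgV) : cfg :=
  [ffun x => match x with inl i => xi i | inr j => eta (inr j) end].

(* eta + delta_x, eta - delta_x (only used when eta_x > 0, otherwise the
   term carries the factor eta_x = 0), eta - delta_x + delta_y *)
Definition add_site (eta : cfg) (x : V + A) : cfg := [ffun y => (eta y + (y == x))%N].
Definition sub_site (eta : cfg) (x : V + A) : cfg := [ffun y => (eta y - (y == x))%N].
Definition move (eta : cfg) (x y : V + A) : cfg := add_site (sub_site eta x) y.

Definition nat_cfgV (N : nat) (xi : {ffun V -> 'I_N.+1}) : cfgV :=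
  [ffun i => nat_of_ord (xi i)].

Definition phi (s : seq (V + A)) : cfg := [ffun x => count_mem x s].

Definition inOmega (Lam : pred nat) (eta : cfg) : Prop := forall i : V, Lam (eta (inl i)).

Variable R : realType.

(* generator L of a (particle-conserving) configuration process on V with
   rates c(xi, xi'):  Lf(eta) = sum_xi' c(eta_V, xi') [f(xi', eta_abs) - f(eta)];
   by conservation only xi' with the same mass as eta_V matter, and all of
   them are enumerated by {ffun V -> 'I_(mass eta_V).+1}. *)
Definition genL (c : cfgV -> cfgV -> R) (f : cfg -> R) (eta : cfg) : R :=
  \sum_(xi : {ffun V -> 'I_(mass (vpart eta)).+1})
     c (vpart eta) (nat_cfgV xi) * (f (replaceV eta (nat_cfgV xi)) - f eta).

Definition genH (r : V -> A -> R) (f : cfg -> R) (eta : cfg) : R :=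
  \sum_(i : V) \sum_(j : A)
     r i j * (eta (inl i))%:R * (f (move eta (inl i) (inr j)) - f eta).

Definition genLabs c r f eta : R := genL c f eta + genH r f eta.

Definition annih (f : cfg -> R) (eta : cfg) : R :=
  \sum_(x : V + A) (eta x)%:R * f (sub_site eta x).

(* E_eta[f(eta(t))] = (e^{t L^abs} f)(eta); the dynamics conserves the
   number of particles, so this is a finite-dimensional matrix exponential *)
Definition semigroup c r (t : R) (f : cfg -> R) (eta : cfg) : R :=
  limn (fun N => \sum_(k < N) (t ^+ k / (k`!)%:R * iter k (genLabs c r) f eta)).

Definition Einf c r (f : cfg -> R) (eta : cfg) : R :=
  lim (semigroup c r t f eta @[t --> +oo%R]).

Definition Pinf c r (eta zeta : cfg) : R :=
  Einf c r (fun xi => (xi == zeta)%:R) eta.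

Definition Fdual (zeta eta : cfg) : R :=
  \prod_(j : A) ('C(eta (inr j), zeta (inr j)))%:R.

Definition in_Omega_abs (m : nat) (zeta : cfg) : Prop :=
  (forall i : V, zeta (inl i) = 0%N) /\ massT zeta = m.

End Defs.

(* Main.v *)
(* Annihilating p particles of phi(x) sums p! f(phi(x_S)) over the subfamilies S of size n - p, and
   applied to the indicator of zeta it gives p! F(zeta, .) on configurations of mass |zeta| + p.
   Since L^abs commutes with annihilation, the k-th powers of L^abs, hence the semigroups at each
   time t, satisfy the claimed identity; the theorem follows by letting t tend to infinity.

   The limits exist for any finite-state jump generator L.  Uniformize: L = lam (T - 1) with T a
   sup-norm contraction.  Every f splits as g + L h with L g = 0, and e^{tL} L h tends to 0:
   e^{tL} is a Poisson(lam t) average of the powers T^k, so e^{tL} (T - 1) h is bounded by the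
   total variation distance between the Poisson law and its shift, of order 1 / sqrt (lam t). *)

Require Import Defs.
From HB Require Import structures.
From mathcomp Require Import all_boot all_order all_algebra.
From mathcomp Require Import all_classical all_reals all_analysis.
From mathcomp Require Import ring lra zify.
Import Order.TTheory GRing.Theory Num.Theory.
Import numFieldNormedType.Exports.
Local Open Scope classical_set_scope.
Local Open Scope ring_scope.

(** * Poisson sums of a bounded sequence and of its differences *)

Section PoissonSums.
Variable R : realType.
Implicit Types (a : nat -> R) (s C : R).

Definition fdiff a : nat -> R := fun k => a k.+1 - a k.

(** Binomial expansion of [(E - 1)^k] with [E] the shift; the sign exponent is [k + i] instead of
    [k - i] to avoid truncated subtraction. *)
Lemma iter_fdiff a k j :
  iter k fdiff a j = \sum_(i < k.+1) (-1) ^+ (k + i) * 'C(k, i)%:R * a (j + i)%N.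
Proof.
elim: k a j => [|k IH] a j; first by rewrite big_ord1 addn0 expr0 bin0 !mul1r addn0.
rewrite iterS {1}/fdiff !IH [RHS]big_ord_recl /= bin0 addn0.
rewrite [X in _ = _ + X](eq_bigr (fun i : 'I_k.+1 =>
    (-1) ^+ (k + i) * 'C(k, i)%:R * a (j.+1 + i)%N +
    (-1) ^+ (k + i) * 'C(k, i.+1)%:R * a (j.+1 + i)%N)); last first.
  by move=> i _; rewrite /bump /= add1n binS natrD -addSnnS addnS addSn !exprS; ring.
rewrite big_split /= [X in _ = _ + (_ + X)]big_ord_recr /= bin_small // mulr0 mul0r addr0.
rewrite [X in _ - X]big_ord_recl /= bin0 !addn0.
rewrite (eq_bigr (fun i : 'I_k => - ((-1) ^+ (k + i) * 'C(k, i.+1)%:R * a (j.+1 + i)%N))).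
  by rewrite sumrN exprS; ring.
by move=> i _; rewrite /bump /= add1n addnS exprS addSnnS; ring.
Qed.

Lemma sum_triangle (u v : nat -> R) N :
  \sum_(k < N) \sum_(j < k.+1) u j * v (k - j)%N =
  \sum_(j < N) u j * \sum_(l < N - j) v l.
Proof.
elim: N => [|N IH]; first by rewrite !big_ord0.
rewrite big_ord_recr /= IH [RHS]big_ord_recr /= subSnn big_ord1 big_ord_recr /= subnn.
rewrite addrA; congr (_ + _); rewrite -big_split /=; apply: eq_bigr => j _.
by rewrite subSn ?(ltnW (ltn_ord j)) // big_ord_recr /= mulrDr.
Qed.

Lemma bin_div_fact (k i : nat) : (i <= k)%N ->
  'C(k, i)%:R / k`!%:R = (i`!%:R)^-1 * ((k - i)`!%:R)^-1 :> R.
Proof.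
move=> ik; have f0 n : (n`!%:R : R) != 0 by rewrite pnatr_eq0 -lt0n fact_gt0.
by rewrite -(bin_fact ik) !natrM; field; rewrite !f0 pnatr_eq0 -lt0n bin_gt0 ik.
Qed.

Lemma cvg_exp_sum s : \sum_(k < N) s ^+ k / k`!%:R @[N --> \oo] --> expR s.
Proof.
have -> : (fun N => \sum_(k < N) s ^+ k / k`!%:R) = series (exp_coeff s).
  by apply/funext => N; rewrite /series /= big_mkord.
exact: is_cvg_series_exp_coeff.
Qed.

Lemma exp_sum_le s N : 0 <= s -> \sum_(k < N) s ^+ k / k`!%:R <= expR s.
Proof.
move=> s0; apply: (cvgr_to_ge (cvg_exp_sum s)); near=> M.
have NM : (N <= M)%N by near: M; exact: nbhs_infty_ge.
rewrite -(subnKC NM) big_split_ord /= lerDl sumr_ge0 // => i _.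
by rewrite divr_ge0 ?exprn_ge0.
Unshelve. all: end_near. Qed.

Lemma exp_sumD s N : \sum_(j < N) s ^+ j / j`!%:R * (\sum_(l < N - j) s ^+ l / l`!%:R) =
  \sum_(k < N) (s + s) ^+ k / k`!%:R.
Proof.
rewrite -(sum_triangle (fun j => s ^+ j / j`!%:R) (fun l => s ^+ l / l`!%:R)).
apply: eq_bigr => k _; rewrite exprDn mulr_suml; apply: eq_bigr => i _.
have ik : (i <= k)%N by rewrite -ltnS.
transitivity (s ^+ (k - i) * s ^+ i * ('C(k, i)%:R / k`!%:R)).
  by rewrite bin_div_fact //; ring.
by rewrite -[_ *+ 'C(k, i)]mulr_natr; ring.
Qed.

(** The tails of the two exponential series compare term by term. *)
Lemma exp_sum_tail s M : 0 <= s ->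
  `|\sum_(l < M) (- s) ^+ l / l`!%:R - expR (- s)| <=
  expR s - \sum_(l < M) s ^+ l / l`!%:R.
Proof.
move=> s0.
have cvl : `|\sum_(l < M) (- s) ^+ l / l`!%:R - \sum_(l < K) (- s) ^+ l / l`!%:R|
    @[K --> \oo] --> `|\sum_(l < M) (- s) ^+ l / l`!%:R - expR (- s)|.
  by apply: cvg_norm; apply: cvgB; [exact: cvg_cst | exact: cvg_exp_sum].
have cvr : \sum_(l < K) s ^+ l / l`!%:R - \sum_(l < M) s ^+ l / l`!%:R
    @[K --> \oo] --> expR s - \sum_(l < M) s ^+ l / l`!%:R.
  by apply: cvgB; [exact: cvg_exp_sum | exact: cvg_cst].
apply: (ler_cvg_to cvl cvr).
near=> K; have MK : (M <= K)%N by near: K; exact: nbhs_infty_ge.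
rewrite distrC -(subnKC MK) !big_split_ord /= !(addrC (\sum_(i < M) _)) !addrK.
apply: le_trans (ler_norm_sum _ _ _) _; apply: ler_sum => i _.
by rewrite normrM normfV normrX normrN ger0_norm // (ger0_norm (_ : 0 <= _%:R)).
Unshelve. all: end_near. Qed.

(** Formally [e^(s (E - 1)) = e^(-s) e^(s E)] for the shift [E]. After rearrangement, index [j]
    carries only the first [N - j] terms of [e^(-s)]. By [exp_sum_tail] these truncations cost at
    most [C (e_N(s) e^s - e_N(2 s))], with [e_N] the partial sums of the exponential, and this tends
    to 0. *)
Lemma poisson_transform_sub a C s : (forall k, `|a k| <= C) -> 0 <= s ->
  (\sum_(k < N) s ^+ k / k`!%:R * iter k fdiff a 0 -
   expR (- s) * \sum_(k < N) s ^+ k / k`!%:R * a k) @[N --> \oo] --> 0.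
Proof.
move=> aC s0; apply: norm_cvg0.
have C0 : 0 <= C by apply: le_trans (aC 0%N).
apply: (@squeeze_cvgr _ _ _ _ (fun=> 0) (fun N : nat =>
  C * ((\sum_(k < N) s ^+ k / k`!%:R) * expR s - \sum_(k < N) (s + s) ^+ k / k`!%:R))).
- near=> N; rewrite normr_ge0 /=.
  have -> : \sum_(k < N) s ^+ k / k`!%:R * iter k fdiff a 0 =
    \sum_(j < N) (s ^+ j / j`!%:R * a j) * \sum_(l < N - j) (- s) ^+ l / l`!%:R.
    rewrite -(sum_triangle (fun j => s ^+ j / j`!%:R * a j) (fun l => (- s) ^+ l / l`!%:R)).
    apply: eq_bigr => k _; rewrite iter_fdiff mulr_sumr; apply: eq_bigr => i _.
    have ik : (i <= k)%N by rewrite -ltnS.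
    rewrite add0n.
    transitivity (s ^+ k * (-1) ^+ (k + i) * a i * ('C(k, i)%:R / k`!%:R)); first by ring.
    (* With [k = i + (k - i)] the sign is [(-1)^(2 i) (-1)^(k - i)], and the last factor turns
       [s^(k - i)] into [(- s)^(k - i)]. *)
    rewrite bin_div_fact // -{1 2}(subnKC ik) addnAC addnn !exprD.
    by rewrite -mul2n exprM sqrrN expr1n expr1n mul1r (exprNn s); ring.
  rewrite mulr_sumr -sumrB -exp_sumD mulr_suml -sumrB mulr_sumr.
  apply: le_trans (ler_norm_sum _ _ _) _; apply: ler_sum => j _.
  have p0 : 0 <= s ^+ j / j`!%:R by rewrite divr_ge0 ?exprn_ge0.
  rewrite (mulrC (expR _)) -mulrBr -mulrBr !normrM -normrM (ger0_norm p0) mulrA (mulrC C).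
  apply: ler_pM => //; first by rewrite mulr_ge0.
    by rewrite ler_wpM2l.
  exact: exp_sum_tail.
- exact: cvg_cst.
- have e0 : C * (expR s * expR s - expR (s + s)) = 0 by rewrite expRD subrr mulr0.
  rewrite -[X in _ --> X]e0; apply: cvgMl_tmp; apply: cvgB; last exact: cvg_exp_sum.
  by apply: cvgMr_tmp; exact: cvg_exp_sum.
Unshelve. all: end_near. Qed.

Lemma is_cvg_exp_sum_bounded a C s : (forall k, `|a k| <= C) -> 0 <= s ->
  cvgn (fun N => \sum_(k < N) s ^+ k / k`!%:R * a k).
Proof.
move=> aC s0; have C0 : 0 <= C by apply: le_trans (aC 0%N).
have -> : (fun N => \sum_(k < N) s ^+ k / k`!%:R * a k) =
          series (fun k => s ^+ k / k`!%:R * a k).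
  by apply/funext => N; rewrite /series /= big_mkord.
apply: normed_cvg.
apply: (@series_le_cvg _ _ (fun k => C * exp_coeff s k)) => [k|k|k|].
- exact: normr_ge0.
- by rewrite mulr_ge0 // exp_coeff_ge0.
- have p0 : 0 <= s ^+ k / k`!%:R by rewrite divr_ge0 ?exprn_ge0.
  by rewrite /= normrM (ger0_norm p0) mulrC /exp_coeff /= ler_wpM2r.
- exact/is_cvg_seriesZ/is_cvg_series_exp_coeff.
Qed.

Lemma exp_termS s N :
  N.+1%:R * (s ^+ N.+1 / N.+1`!%:R) = s * (s ^+ N / N`!%:R).
Proof.
have f0 : (N`!%:R : R) != 0 by rewrite pnatr_eq0 -lt0n fact_gt0.
have : (N.+1%:R : R) != 0 by rewrite pnatr_eq0.
rewrite factS natrM exprS; move: (N.+1%:R) => w w0.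
by field; rewrite f0 w0.
Qed.

(** Truncated form of the fact that the Poisson variance is [s]; for [s >= 0] the boundary term is
    nonpositive once [N >= s]. *)
Lemma poisson_variance s N : \sum_(k < N) s ^+ k / k`!%:R * (k%:R - s) ^+ 2 =
  s * (\sum_(k < N) s ^+ k / k`!%:R) + N%:R * (s ^+ N / N`!%:R) * (s - N%:R).
Proof.
elim: N => [|N IH]; first by rewrite !big_ord0 mulr0 !mul0r addr0.
rewrite !big_ord_recr /= IH exp_termS.
by rewrite -(natr1 N); ring.
Qed.

(** As the weights satisfy [k w_k = s w_(k-1)], the difference passes from [a] to the weights, where
    it becomes the factor [k - s]. *)
Lemma poisson_summation_by_parts a s N :
  s * (\sum_(k < N) s ^+ k / k`!%:R * fdiff a k) =
  \sum_(k < N) s ^+ k / k`!%:R * (k%:R - s) * a k + N%:R * (s ^+ N / N`!%:R) * a N.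
Proof.
elim: N => [|N IH]; first by rewrite !big_ord0 mulr0 !mul0r addr0.
rewrite !big_ord_recr /= mulrDr IH exp_termS.
by rewrite /fdiff; ring.
Qed.

(* The Poisson law has standard deviation [sqrt s], so its weights vary by [O(1 / sqrt s)] in
   total variation: [eps] may be taken of order [1 / sqrt s]. *)
Lemma poisson_fdiff_small a C s eps : (forall k, `|a k| <= C) -> 0 < eps ->
  eps ^- 2 <= s ->
  `|limn (fun N => \sum_(k < N) s ^+ k / k`!%:R * fdiff a k)| <= C * eps * expR s.
Proof.
move=> aC e0 es; have C0 : 0 <= C by apply: le_trans (aC 0%N).
have s0 : 0 < s by apply: lt_le_trans es; rewrite invr_gt0 exprn_gt0.
have dC k : `|fdiff a k| <= C + C.
  by apply: le_trans (ler_normB _ _) _; rewrite lerD.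
have cv := is_cvg_exp_sum_bounded _ _ _ dC (ltW s0).
have cp : C * (s ^+ N / N`!%:R) + C * eps * expR s @[N --> \oo] --> C * eps * expR s.
  rewrite -[X in _ --> X]add0r -[X in X + _](mulr0 C).
  apply: cvgD; last exact: cvg_cst.
  by apply: cvgMl_tmp; exact: cvg_exp_coeff.
(* With sums of length [N.+1], [exp_termS] turns the boundary term into [s] times the [N]-th weight
   times [a N.+1]; the weight tends to 0. *)
have cv' : (fun N => \sum_(k < N.+1) s ^+ k / k`!%:R * fdiff a k) x @[x --> \oo] -->
   limn (fun N => \sum_(k < N) s ^+ k / k`!%:R * fdiff a k).
  by rewrite (cvg_shiftS (fun N => \sum_(k < N) s ^+ k / k`!%:R * fdiff a k)).
apply: (ler_cvg_to (cvg_norm cv') cp); near=> N.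
have sN : s <= N.+1%:R.
  apply: le_trans (_ : N%:R <= _); last by rewrite ler_nat.
  near: N; exact: nbhs_infty_ger.
rewrite -(ler_pM2l s0) -{1}(gtr0_norm s0) -normrM poisson_summation_by_parts.
apply: le_trans (ler_normD _ _) _; rewrite addrC mulrDr; apply: lerD.
  rewrite exp_termS.
  have p0 : 0 <= s * (s ^+ N / N`!%:R) by rewrite mulr_ge0 ?divr_ge0 ?exprn_ge0 ?ltW.
  by rewrite normrM (ger0_norm p0) [leRHS]mulrCA [leRHS]mulrC ler_wpM2l.
apply: le_trans (ler_norm_sum _ _ _) _.
apply: (@le_trans _ _ (C * \sum_(k < N.+1) s ^+ k / k`!%:R * `|k%:R - s|)).
  rewrite mulr_sumr; apply: ler_sum => k _.
  have p0 : 0 <= s ^+ k / k`!%:R by rewrite divr_ge0 ?exprn_ge0 ?ltW.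
  by rewrite normrM normrM (ger0_norm p0) mulrC ler_wpM2r // mulr_ge0.
rewrite mulrCA -!mulrA ler_wpM2l //.
have es0 : 0 < eps * s by rewrite mulr_gt0.
(* AM-GM: [2 |k - s| <= eps s + (k - s)^2 / (eps s)] *)
have amgm (k : nat) : `|k%:R - s| <= (eps * s + (k%:R - s) ^+ 2 / (eps * s)) / 2.
  rewrite -[(_ - s) ^+ 2]real_normK ?num_real //; move: `|_| => y.
  rewrite ler_pdivlMr // -(ler_pM2l es0).
  have -> : eps * s * (eps * s + y ^+ 2 / (eps * s)) = (eps * s) ^+ 2 + y ^+ 2.
    by field; rewrite !gt_eqF.
  have := sqr_ge0 (eps * s - y); nra.
apply: (@le_trans _ _ (\sum_(k < N.+1) (eps * s / 2 * (s ^+ k / k`!%:R) +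
    (2 * eps * s)^-1 * (s ^+ k / k`!%:R * (k%:R - s) ^+ 2)))).
  apply: ler_sum => k _.
  have p0 : 0 <= s ^+ k / k`!%:R by rewrite divr_ge0 ?exprn_ge0 ?ltW.
  apply: le_trans (ler_wpM2l p0 (amgm k)) _.
  rewrite le_eqVlt; apply/orP; left; apply/eqP.
  have f0 : (k`!%:R : R) != 0 by rewrite pnatr_eq0 -lt0n fact_gt0.
  by field; rewrite f0 !gt_eqF.
rewrite big_split /= -!mulr_sumr poisson_variance.
set En := \sum_(k < N.+1) _; have En0 : 0 <= En.
  by apply: sumr_ge0 => k _; rewrite divr_ge0 ?exprn_ge0 ?ltW.
have EnE : En <= expR s by apply: exp_sum_le; exact: ltW.
apply: (@le_trans _ _ (eps * s / 2 * En + (2 * eps * s)^-1 * (s * En))).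
  rewrite lerD2l; apply: ler_wpM2l; first by rewrite invr_ge0 !mulr_ge0 ?ltW.
  rewrite gerDl.
  by rewrite mulr_ge0_le0 ?subr_le0 // mulr_ge0 ?divr_ge0 ?exprn_ge0 ?ltW.
have -> : (2 * eps * s)^-1 * (s * En) = eps * eps ^- 2 / 2 * En.
  by field; rewrite !gt_eqF.
(* The assumption on [s] makes the second half of the AM-GM bound no larger than the first. *)
have eps2 : eps * eps ^- 2 <= eps * s by rewrite ler_wpM2l // ltW.
apply: (@le_trans _ _ (eps * s * En)).
  rewrite -mulrDl ler_wpM2r //; lra.
by rewrite [leRHS]mulrCA [leRHS]mulrA (mulrC s) ler_wpM2l // ltW.
Unshelve. all: end_near. Qed.

End PoissonSums.

Arguments fdiff {R} a k : simpl never.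

Lemma cvg_near_eq {R : realType} {T : Type} {F : set_system T} {FF : Filter F}
    {f g : T -> R} {l : R} :
  f x @[x --> F] --> l -> (\forall x \near F, f x = g x) -> g x @[x --> F] --> l.
Proof.
move=> fl fg; apply: cvg_trans fl; apply: near_eq_cvg.
by apply: filterS fg => x ->.
Qed.

(** * Iterates of a linear operator on functions *)

Section LinearOperator.
Variables (R : realType) (X : Type) (L : (X -> R) -> X -> R).
Hypothesis L_lin : forall a f g x, L (fun y => a * f y + g y) x = a * L f x + L g x.

Lemma iter_lin k a f g x :
  iter k L (fun y => a * f y + g y) x = a * iter k L f x + iter k L g x.
Proof.
elim: k x => [//|k IH] x.
by rewrite !iterS (_ : iter k L _ = fun y => a * iter k L f y + iter k L g y) ?L_lin //; exact/funext.
Qed.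

Lemma iter_lin0 k x : iter k L (fun=> 0) x = 0.
Proof.
rewrite (_ : (fun=> 0) = fun y : X => -1 * 0 + 0).
  by rewrite iter_lin mulN1r addNr.
by apply/funext => y; rewrite mulr0 addr0.
Qed.

Lemma iter_scale k a f x : iter k L (fun y => a * f y) x = a * iter k L f x.
Proof.
rewrite (_ : (fun y => a * f y) = fun y => a * f y + 0).
  by rewrite (iter_lin _ _ _ (fun=> 0)) iter_lin0 addr0.
by apply/funext => y; rewrite addr0.
Qed.

Lemma lin_sum (I : Type) (r : seq I) (u : I -> R) (F : I -> X -> R) x :
  L (fun y => \sum_(i <- r) u i * F i y) x = \sum_(i <- r) u i * L (F i) x.
Proof.
elim: r => [|i r IH].
  rewrite big_nil -[RHS](iter_lin0 1 x) /=; congr (L _ x).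
  by apply/funext => y; rewrite big_nil.
rewrite big_cons -IH -L_lin; congr (L _ x).
by apply/funext => y; rewrite big_cons.
Qed.

End LinearOperator.

(** * Long-time limit of the exponential of a uniformizable operator *)

Section ContractiveOperator.
Variables (R : realType) (X : eqType) (L : (X -> R) -> X -> R).
Hypothesis L_lin : forall a f g x, L (fun y => a * f y + g y) x = a * L f x + L g x.
Variables (d : nat) (e : 'I_d -> X).
Hypothesis e_inj : injective e.
Variable lam : R.
Hypothesis lam_gt0 : 0 < lam.

(** The uniformized operator [T = 1 + L / lam]. The contraction hypothesis below only looks at the
    finite family [e], as [X] may be infinite. *)
Definition unif f : X -> R := fun x => lam^-1 * L f x + f x.

Hypothesis unif_contr : forall (f : X -> R) (C : R), (forall i, `|f (e i)| <= C) ->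
  forall i, `|unif f (e i)| <= C.

Lemma unifE f x : L f x = lam * (unif f x - f x).
Proof. by rewrite /unif addrK mulrA divff ?mul1r // gt_eqF. Qed.

Lemma iter_unif_contr (f : X -> R) (C : R) : (forall i, `|f (e i)| <= C) ->
  forall k i, `|iter k unif f (e i)| <= C.
Proof. by move=> fC; elim=> [//|k IH] i; apply: unif_contr. Qed.

Lemma bounded_on (f : X -> R) : exists C : R, forall i, `|f (e i)| <= C.
Proof.
exists (\sum_i `|f (e i)|) => i; rewrite (bigD1 i) //= lerDl.
by apply: sumr_ge0 => j _; exact: normr_ge0.
Qed.

(** Contraction with [C = 0], applied to [f - g]: what vanishes on the range of [e] still vanishes
    there after [T]. *)
Lemma op_local (f g : X -> R) : (forall i, f (e i) = g (e i)) -> forall i, L f (e i) = L g (e i).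
Proof.
move=> fg i.
have h0 j : `|-1 * g (e j) + f (e j)| <= 0 by rewrite fg mulN1r addNr normr0.
have := unif_contr (fun y => -1 * g y + f y) 0 h0 i; rewrite /unif L_lin fg !mulN1r addNr addr0 normr_le0.
by rewrite mulf_eq0 invr_eq0 gt_eqF //= addrC subr_eq0 => /eqP.
Qed.

Lemma iter_op_local (f g : X -> R) k : (forall i, f (e i) = g (e i)) ->
  forall i, iter k L f (e i) = iter k L g (e i).
Proof. by move=> fg; elim: k => [//|k IH] i; apply: op_local. Qed.

(** Powers of [L = lam (T - 1)] act as differences in the exponent of [T]; a general [j] carries the
    induction. *)
Lemma iter_op_fdiff f x k j : iter k L (iter j unif f) x =
  lam ^+ k * iter k fdiff (fun i => iter i unif f x) j.
Proof.
elim: k j => [|k IH] j; first by rewrite mul1r.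
rewrite iterSr (_ : L _ = fun y => lam * (-1 * iter j unif f y + iter j.+1 unif f y)).
  by rewrite iter_scale // iter_lin // !IH iterS /fdiff exprS; ring.
by apply/funext => y; rewrite unifE mulN1r addrC.
Qed.

(** [T] commutes with [L]. On the range of [L] the Poisson average thus becomes one of differences,
    as [poisson_fdiff_small] requires. *)
Lemma iter_unif_op f x k :
  iter k unif (L f) x = lam * fdiff (fun j => iter j unif f x) k.
Proof.
rewrite /fdiff iterS -unifE; elim: k x => [//|k IH] x.
rewrite iterS {1}/unif (_ : iter k unif (L f) = L (iter k unif f)); last exact/funext.
by rewrite iterS {2}/unif L_lin.
Qed.

(* If [L (L f) = 0] then [unif^k f = f + (k / lam) L f], which stays bounded only when
   [L f = 0]. *)
Lemma op_ker_sqr (f : X -> R) : (forall i, L (L f) (e i) = 0) -> forall i, L f (e i) = 0.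
Proof.
move=> LL0 i.
have iterE k : forall j, iter k unif f (e j) = k%:R / lam * L f (e j) + f (e j).
  elim: k => [|k IH] j; first by rewrite !mul0r add0r.
  rewrite iterS /unif IH (op_local _ (fun y => k%:R / lam * L f y + f y)) //.
  by rewrite L_lin LL0 -natr1; ring.
have [C fC] := bounded_on f.
apply/eqP; apply: contraT => Lf0.
set y := `|L f (e i)| / lam.
have y0 : 0 < y by rewrite divr_gt0 // normr_gt0.
(* Chosen so that [k * y > 2 * C], whereas [k * y] is the modulus of [T^k f - f], at most
   [2 * C]. *)
pose k := Num.bound (2 * C / y).
have : 2 * C / y < k%:R.
  apply: archi_boundP; apply: divr_ge0 (ltW y0); apply: mulr_ge0 => //.
  exact: le_trans (fC i).
rewrite ltr_pdivrMr // ltNge => /negP[].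
have -> : k%:R * y = `|iter k unif f (e i) - f (e i)|.
  rewrite iterE addrK normrM ger0_norm ?divr_ge0 ?ltW // /y; ring.
by apply: le_trans (ler_normB _ _) _; rewrite mulr_natl mulr2n lerD ?iter_unif_contr.
Qed.

(* The kernel of [L] meets its range trivially, so [L] and [L^2] have the same rank. *)
Lemma op_range_sqr f : exists h, forall i, L f (e i) = L (L h) (e i).
Proof.
(* [F u] extends the row [u] by zero outside the range of [e]; on such functions [L] is right
   multiplication by the matrix [M]. *)
pose F (u : 'rV[R]_d) (y : X) : R := \sum_i u 0 i * (y == e i)%:R.
have FE u j : F u (e j) = u 0 j.
  rewrite /F (bigD1 j) //= eqxx mulr1 big1 ?addr0 // => i ij.
  by rewrite (inj_eq e_inj) eq_sym (negPf ij) mulr0.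
pose M : 'M[R]_d := \matrix_(i, j) L (fun y => (y == e i)%:R) (e j).
have ME u j : L (F u) (e j) = (u *m M) 0 j.
  by rewrite /F lin_sum // mxE; apply: eq_bigr => i _; rewrite mxE.
have MME u j : L (L (F u)) (e j) = (u *m M *m M) 0 j.
  by rewrite -ME; apply: op_local => i; rewrite FE ME.
have cap0 : (M :&: kermx M)%MS = 0.
  apply/eqP/rowV0P => v; rewrite sub_capmx => /andP[/submxP[w ->] /sub_kermxP wMM].
  apply/rowP => j; rewrite [RHS]mxE -ME; apply: op_ker_sqr => i.
  by rewrite MME wMM mxE.
(* The ranks of [M] and [M *m M] differ by the rank of the intersection just shown to be zero. *)
have MM : (M <= M *m M)%MS.
  by rewrite -(mxrank_leqif_sup (submxMl M M)) -(mxrank_mul_ker M M) cap0 mxrank0 addn0.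
pose u := \row_i f (e i).
have /submxP[h hE] := submx_trans (submxMl u M) MM.
exists (F h) => i; rewrite MME -mulmxA -hE -ME; apply: op_local => j.
by rewrite FE mxE.
Qed.

(** This is [e^(tL) = e^(-lam t) e^(lam t T)]: take [a k = T^k f (e i)] and [s = lam t] in
    [poisson_transform_sub]. *)
Lemma op_exp_cvg f i t : 0 <= t ->
  \sum_(k < N) t ^+ k / k`!%:R * iter k L f (e i) @[N --> \oo] -->
  expR (- (lam * t)) *
  limn (fun N => \sum_(k < N) (lam * t) ^+ k / k`!%:R * iter k unif f (e i)).
Proof.
move=> t0; have [C fC] := bounded_on f.
have aC k := iter_unif_contr _ _ fC k i.
have s0 : 0 <= lam * t by rewrite mulr_ge0 // ltW.
have cv := is_cvg_exp_sum_bounded _ _ _ _ aC s0.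
rewrite -[X in _ --> X]add0r.
apply: (cvg_near_eq (cvgD (poisson_transform_sub _ _ _ _ aC s0) (cvgMl_tmp cv))); near=> N.
rewrite /= subrK; apply: eq_bigr => k _.
by rewrite (iter_op_fdiff _ _ k 0) exprMn; ring.
Unshelve. all: end_near. Qed.

Lemma op_exp_range_cvg0 f i :
  limn (fun N => \sum_(k < N) t ^+ k / k`!%:R * iter k L (L f) (e i)) @[t --> +oo] --> 0.
Proof.
have [C fC] := bounded_on f.
have C0 : 0 <= C by apply: le_trans (fC i).
apply/cvgr0Pnorm_le => eps eps0.
(* Chosen so that [lam * (C + 1) * e' = eps]; the [+ 1] keeps the denominator positive when
   [C = 0]. *)
have e'0 : 0 < eps / (lam * (C + 1)) by rewrite divr_gt0 // mulr_gt0 // ltr_wpDl.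
set e' := eps / _ in e'0.
near=> t.
have t0 : 0 <= t by near: t; exact: nbhs_pinfty_ge.
have st : e' ^- 2 <= lam * t.
  rewrite mulrC -ler_pdivrMr //; near: t; apply: nbhs_pinfty_ge; exact: num_real.
rewrite (cvg_lim _ (op_exp_cvg _ i t t0)) //.
set S := limn _.
have SE : S = lam * limn (fun N => \sum_(k < N) (lam * t) ^+ k / k`!%:R *
                 fdiff (fun j => iter j unif f (e i)) k).
  apply: cvg_lim => //.
  have dC k : `|fdiff (fun j => iter j unif f (e i)) k| <= C + C.
    by apply: le_trans (ler_normB _ _) _; rewrite lerD // iter_unif_contr.
  have s0 : 0 <= lam * t by rewrite mulr_ge0 // ltW.
  apply: (cvg_near_eq (cvgMl_tmp (a := lam) (is_cvg_exp_sum_bounded _ _ _ _ dC s0))); near=> N.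
  by rewrite /= mulr_sumr; apply: eq_bigr => k _; rewrite iter_unif_op; ring.
have aC k := iter_unif_contr _ _ fC k i.
have := poisson_fdiff_small _ _ _ _ _ aC e'0 st.
rewrite SE normrM (ger0_norm (expR_ge0 _)) normrM (gtr0_norm lam_gt0).
set Y := `|_|; rewrite -(ler_pM2l (expR_gt0 (- (lam * t)))) -(ler_pM2l lam_gt0).
rewrite mulrCA => /le_trans; apply.
rewrite (mulrCA (expR _)) -expRD addNr expR0 mulr1 mulrA.
have -> : eps = lam * (C + 1) * e'.
  by rewrite /e'; field; rewrite !gt_eqF // ltr_wpDl.
by rewrite ler_wpM2r ?(ltW e'0) // ler_wpM2l ?(ltW lam_gt0) // lerDl.
Unshelve. all: end_near. Qed.

(** With [L f = L (L h)] on the range of [e], there [e^(tL)] fixes [f - L h] and sends [L h] to 0 as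
    [t] grows, so the limit is [f - L h]. *)
Lemma op_exp_lim_cvg f i :
  cvg (limn (fun N => \sum_(k < N) t ^+ k / k`!%:R * iter k L f (e i)) @[t --> +oo]).
Proof.
have [h hE] := op_range_sqr f.
apply/cvg_ex; exists (f (e i) - L h (e i)); rewrite -[X in _ --> X]addr0.
apply: (cvg_near_eq (cvgD (cvg_cst (f (e i) - L h (e i))) (op_exp_range_cvg0 h i))); near=> t.
have t0 : 0 <= t by near: t; exact: nbhs_pinfty_ge.
apply/esym; apply: cvg_lim => //=.
have := op_exp_cvg (L h) i t t0; move=> /[dup] /cvg_lim <- // cv.
apply: (cvg_near_eq (cvgD (cvg_cst (f (e i) - L h (e i))) cv)); near=> N.
(* A positive [N] lets the term [k = 0] be split off, the only one where [f] and [L h] can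
   differ. *)
have -> : N = N.-1.+1 by rewrite prednK //; near: N; exact: nbhs_infty_gt.
rewrite /= !big_ord_recl /= !expr0 !fact0 !divr1 !mul1r addrA subrK; congr (_ + _).
apply: eq_bigr => k _; rewrite !add0n -!iterS !iterSr; congr (_ * _).
by apply: iter_op_local => j; rewrite hE.
Unshelve. all: end_near. Qed.

End ContractiveOperator.

(** * Uniformization of jump generators *)

Section JumpGenerator.
Variables (R : realType) (X : eqType) (W : X -> finType).
Variables (rate : forall x, W x -> R) (tgt : forall x, W x -> X).

(** The index type [W x] depends on the state because the enumeration of targets in [genL] grows
    with the bulk mass. *)
Definition jump_gen (f : X -> R) (x : X) : R :=
  \sum_(w : W x) rate x w * (f (tgt x w) - f x).

Lemma jump_gen_lin a f g x :
  jump_gen (fun y => a * f y + g y) x = a * jump_gen f x + jump_gen g x.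
Proof. by rewrite /jump_gen mulr_sumr -big_split; apply: eq_bigr => w _ /=; ring. Qed.

Lemma jump_gen_local (D : X -> Prop) (f g : X -> R) :
  (forall x w, D x -> rate x w != 0 -> D (tgt x w)) ->
  (forall x, D x -> f x = g x) -> forall x, D x -> jump_gen f x = jump_gen g x.
Proof.
move=> closed fg x Dx; apply: eq_bigr => w _.
have [->|r0] := eqVneq (rate x w) 0; first by rewrite !mul0r.
by rewrite !fg //; exact: closed.
Qed.

Lemma iter_jump_gen_local (D : X -> Prop) (f g : X -> R) k :
  (forall x w, D x -> rate x w != 0 -> D (tgt x w)) ->
  (forall x, D x -> f x = g x) ->
  forall x, D x -> iter k jump_gen f x = iter k jump_gen g x.
Proof.
by move=> closed fg; elim: k => [//|k IH]; exact: (jump_gen_local D).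
Qed.

Hypothesis rate_ge0 : forall x w, 0 <= rate x w.
Variables (d : nat) (e : 'I_d -> X).
Hypothesis e_inj : injective e.
Hypothesis e_closed : forall i w, rate (e i) w != 0 -> exists j, tgt (e i) w = e j.

(** The sum of all exit rates in the sector serves as a bound for each of them; the [1] keeps [lam]
    positive when no jump is possible. *)
Let lam : R := 1 + \sum_(i < d) \sum_(w : W (e i)) rate (e i) w.

Let lam_gt0 : 0 < lam.
Proof. by rewrite ltr_wpDr // sumr_ge0 // => i _; rewrite sumr_ge0. Qed.

(** [T f] is an average of [f] with weights [rate / lam] and [1 - q / lam], [q] being the exit rate,
    and jumps of nonzero rate stay in the range of [e]. *)
Let unif_contr (f : X -> R) (C : R) : (forall i, `|f (e i)| <= C) ->
  forall i, `|unif _ _ jump_gen lam f (e i)| <= C.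
Proof.
move=> fC i; rewrite /unif.
set q := \sum_(w : W (e i)) rate (e i) w.
have qlam : q <= lam.
  rewrite /lam (bigD1 i) //= -/q addrCA lerDl addr_ge0 //.
  by rewrite sumr_ge0 // => j _; rewrite sumr_ge0.
have -> : lam^-1 * jump_gen f (e i) + f (e i) =
    lam^-1 * (\sum_(w : W (e i)) rate (e i) w * f (tgt (e i) w) + (lam - q) * f (e i)).
  have -> : jump_gen f (e i) =
      \sum_(w : W (e i)) rate (e i) w * f (tgt (e i) w) - q * f (e i).
    rewrite /jump_gen mulr_suml -sumrB; apply: eq_bigr => w _; ring.
  by field; rewrite gt_eqF.
rewrite normrM gtr0_norm ?invr_gt0 // mulrC ler_pdivrMr //.
have -> : C * lam = q * C + (lam - q) * C by ring.
apply: le_trans (ler_normD _ _) _; apply: lerD; last first.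
  by rewrite normrM ger0_norm ?subr_ge0 // ler_wpM2l ?subr_ge0.
apply: le_trans (ler_norm_sum _ _ _) _; rewrite mulr_suml; apply: ler_sum => w _.
have [->|r0] := eqVneq (rate (e i) w) 0; first by rewrite !mul0r normr0.
have [j ->] := e_closed _ _ r0.
by rewrite normrM ger0_norm // ler_wpM2l.
Qed.

Lemma jump_exp_cvg f i t : 0 <= t ->
  cvgn (fun N => \sum_(k < N) (t ^+ k / (k`!)%:R * iter k jump_gen f (e i))).
Proof.
move=> t0; apply/cvg_ex.
by eexists; exact: (op_exp_cvg _ _ _ jump_gen_lin _ _ _ lam_gt0 unif_contr).
Qed.

Lemma jump_exp_lim_cvg f i :
  cvg (limn (fun N => \sum_(k < N) (t ^+ k / (k`!)%:R * iter k jump_gen f (e i)))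
        @[t --> +oo]).
Proof. exact: (op_exp_lim_cvg _ _ _ jump_gen_lin _ _ e_inj _ lam_gt0 unif_contr). Qed.

End JumpGenerator.

(** * Particle number and its finite sectors *)

Section Configurations.
Variables (V A : finType).
Implicit Types (eta zeta : cfg V A).

Lemma massT_add eta x : massT (add_site eta x) = (massT eta).+1.
Proof.
rewrite /massT -addn1 -[in RHS](_ : \sum_y (y == x) = 1)%N -?big_split /=.
  by apply: eq_bigr => y _; rewrite ffunE.
by rewrite (bigD1 x) //= eqxx big1 // => y /negPf ->.
Qed.

Lemma sub_siteK eta x : (0 < eta x)%N -> add_site (sub_site eta x) x = eta.
Proof.
by move=> ex; apply/ffunP => y; rewrite !ffunE; case: eqP => [->|_] /=; lia.
Qed.

Lemma massT_sub eta x : (0 < eta x)%N -> (massT (sub_site eta x)).+1 = massT eta.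
Proof. by move=> ex; rewrite -(massT_add _ x) sub_siteK. Qed.

Lemma massT_replaceV eta xi : mass xi = mass (vpart eta) ->
  massT (replaceV eta xi) = massT eta.
Proof.
rewrite /mass /massT !big_sumType /= => E; congr (_ + _)%N.
  by under eq_bigr do rewrite ffunE; rewrite E; apply: eq_bigr => i _; rewrite ffunE.
by apply: eq_bigr => i _; rewrite ffunE.
Qed.

(** Mass [m] bounds every occupation number by [m], so the sector embeds in a finite function
    type. *)
Lemma massT_sector (m : nat) : exists (d : nat) (e : 'I_d -> cfg V A),
  injective e /\ forall eta, massT eta = m <-> exists i, eta = e i.
Proof.
pose natc (b : {ffun V + A -> 'I_m.+1}) : cfg V A := [ffun x => nat_of_ord (b x)].
have natc_inj : injective natc.
  by move=> b b' /ffunP E; apply/ffunP => x; have := E x; rewrite !ffunE => /val_inj.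
pose P := [pred b | massT (natc b) == m].
exists #|P|, (fun i => natc (enum_val i)); split.
  by move=> i j /natc_inj /enum_val_inj.
move=> eta; split=> [em|[i ->]]; last by apply/eqP; exact: (enum_valP i).
have eta_le x : (eta x <= m)%N by rewrite -em /massT (bigD1 x) //= leq_addr.
pose b : {ffun V + A -> 'I_m.+1} := [ffun x => inord (eta x)].
have bE : natc b = eta by apply/ffunP => x; rewrite !ffunE inordK // ltnS.
have bP : b \in P by rewrite inE bE em.
by exists (enum_rank_in bP b); rewrite enum_rankK_in.
Qed.

End Configurations.

(** * The absorbed generator: convergence, conservation and consistency *)

Section AbsorbedGenerator.
Variables (V A : finType) (R : realType).
Variables (c : cfgV V -> cfgV V -> R) (r : V -> A -> R).

Definition labs_ix (eta : cfg V A) : finType :=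
  ({ffun V -> 'I_(mass (vpart eta)).+1} + V * A)%type.

Definition labs_rate (eta : cfg V A) (w : labs_ix eta) : R :=
  match w with
  | inl xi => c (vpart eta) (nat_cfgV xi)
  | inr p => r p.1 p.2 * (eta (inl p.1))%:R
  end.

Definition labs_tgt (eta : cfg V A) (w : labs_ix eta) : cfg V A :=
  match w with
  | inl xi => replaceV eta (nat_cfgV xi)
  | inr p => move eta (inl p.1) (inr p.2)
  end.

Lemma genLabsE : genLabs c r = jump_gen _ _ _ labs_rate labs_tgt.
Proof.
apply/funext => f; apply/funext => eta.
rewrite /genLabs /jump_gen big_sumType /=; congr (_ + _).
by rewrite /genH pair_big.
Qed.

Hypothesis c_ge0 : forall xi xi', 0 <= c xi xi'.
Hypothesis c_cons : forall xi xi', c xi xi' != 0 -> mass xi' = mass xi.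
Hypothesis r_ge0 : forall i j, 0 <= r i j.

Lemma labs_rate_ge0 eta w : 0 <= labs_rate eta w.
Proof. by case: w => [xi|p] //=; rewrite mulr_ge0. Qed.

(** The occupation factor in the absorption rate matters: at an empty site, [move] would create a
    particle by truncated subtraction. *)
Lemma labs_massT m eta w : massT eta = m -> labs_rate eta w != 0 ->
  massT (labs_tgt eta w) = m.
Proof.
move=> <-; case: w => [xi|[i j]] /=.
  by move=> /c_cons; exact: massT_replaceV.
rewrite mulf_eq0 negb_or pnatr_eq0 -lt0n => /andP[_ ei].
by rewrite massT_add massT_sub.
Qed.

Lemma genLabs_exp_cvg f eta t : 0 <= t ->
  cvgn (fun N => \sum_(k < N) (t ^+ k / (k`!)%:R * iter k (genLabs c r) f eta)).
Proof.
have [d [e [e_inj eP]]] := massT_sector V A (massT eta).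
have /(iffLR (eP _)) [i ->] := erefl (massT eta).
rewrite genLabsE; apply: (jump_exp_cvg _ _ _ _ _ labs_rate_ge0 d e) => {}i w r0.
by apply/eP/labs_massT => //; apply/eP; exists i.
Qed.

Lemma semigroup_lim_cvg f eta : cvg (semigroup c r t f eta @[t --> +oo]).
Proof.
have [d [e [e_inj eP]]] := massT_sector V A (massT eta).
have /(iffLR (eP _)) [i ->] := erefl (massT eta).
rewrite /semigroup genLabsE.
apply: (jump_exp_lim_cvg _ _ _ _ _ labs_rate_ge0 d e) => // {}i w r0.
by apply/eP/labs_massT => //; apply/eP; exists i.
Qed.

Lemma iter_genLabs_scale k a f eta :
  iter k (genLabs c r) (fun y => a * f y) eta = a * iter k (genLabs c r) f eta.
Proof. by rewrite genLabsE iter_scale //; exact: jump_gen_lin. Qed.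

(** Needed because the expression of [Fdual] through annihilations depends on the mass, hence holds
    on one sector at a time. *)
Lemma iter_genLabs_massT k f g m : (forall eta, massT eta = m -> f eta = g eta) ->
  forall eta, massT eta = m -> iter k (genLabs c r) f eta = iter k (genLabs c r) g eta.
Proof.
move=> fg; rewrite genLabsE; apply: (iter_jump_gen_local _ _ _ _ _ (fun eta => massT eta = m)) => //.
by move=> eta w; exact: labs_massT.
Qed.

Variable Lam : pred nat.
Hypothesis Lam_down : forall k, Lam k.+1 -> Lam k.
Hypothesis c_Lam : forall xi xi' : cfgV V, (forall i, Lam (xi i)) -> c xi xi' != 0 ->
             forall i, Lam (xi' i).

Lemma inOmega_sub (eta : cfg V A) x : inOmega Lam eta -> inOmega Lam (sub_site eta x).
Proof.
move=> O i; rewrite ffunE; case: eqP => /= _; last by rewrite subn0.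
by rewrite subn1; have := O i; case: (eta (inl i)) => //= k /Lam_down.
Qed.

(** Consistency is assumed on [inOmega] only, so iterating it requires that jumps stay there;
    [Lam_down] covers the loss of a particle. *)
Lemma labs_inOmega eta w : inOmega Lam eta -> labs_rate eta w != 0 ->
  inOmega Lam (labs_tgt eta w).
Proof.
move=> O; case: w => [xi|[i j]] /= r0 k.
  rewrite ffunE; apply: (c_Lam (vpart eta)) r0 _ => l; rewrite ffunE; exact: O.
by rewrite ffunE addn0; apply: inOmega_sub.
Qed.

Lemma annih_local f g : (forall eta, inOmega Lam eta -> f eta = g eta) ->
  forall eta : cfg V A, inOmega Lam eta -> annih f eta = annih g eta :> R.
Proof.
by move=> fg eta O; apply: eq_bigr => x _; rewrite fg //; exact: inOmega_sub.
Qed.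

Hypothesis consistent : forall (f : cfg V A -> R) (eta : cfg V A), inOmega Lam eta ->
     genLabs c r (annih f) eta = annih (genLabs c r f) eta.

Lemma genLabs_iter_annih p f eta : inOmega Lam eta ->
  genLabs c r (iter p (@annih V A R) f) eta = iter p (@annih V A R) (genLabs c r f) eta.
Proof.
elim: p eta => [//|p IH] eta O.
by rewrite !iterS consistent //; apply: annih_local.
Qed.

Lemma iter_genLabs_annih k p f eta : inOmega Lam eta ->
  iter k (genLabs c r) (iter p (@annih V A R) f) eta =
  iter p (@annih V A R) (iter k (genLabs c r) f) eta.
Proof.
elim: k eta => [//|k IH] eta O; rewrite !iterS -genLabs_iter_annih //.
(* The induction hypothesis is an equality on [inOmega]; it passes under the generator since jumps
   preserve this set. *)
rewrite genLabsE; apply: (jump_gen_local _ _ _ _ _ (inOmega Lam)) => //.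
  by move=> *; exact: labs_inOmega.
by rewrite -genLabsE.
Qed.

End AbsorbedGenerator.

(** * Annihilation as a count of subfamilies of particles *)

Section SubconfigurationCounting.
Variables (V A : finType) (R : realType).
Local Notation annih := (@annih V A R).

(** Particles keep their labels in ['I_n], so that those sharing a site are counted separately. *)
Definition subphi n (x : n.-tuple (V + A)%type) (T : {set 'I_n}) : cfg V A :=
  phi [seq tnth x i | i <- enum T].

Lemma subphiE n (x : n.-tuple (V + A)%type) T y :
  subphi n x T y = (\sum_(i in T) (tnth x i == y))%N.
Proof. by rewrite ffunE count_map -sum1_count -big_mkcondr big_enum_cond /=. Qed.

Lemma subphi_setT n (x : n.-tuple (V + A)%type) : subphi n x [set: 'I_n] = phi x.
Proof. by rewrite /subphi enum_setT -enumT map_tnth_enum. Qed.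

Lemma massT_subphi n (x : n.-tuple (V + A)%type) T : massT (subphi n x T) = #|T|.
Proof.
rewrite /massT; under eq_bigr do rewrite subphiE.
rewrite exchange_big /= -sum1_card; apply: eq_bigr => i _.
by rewrite (bigD1 (tnth x i)) //= eqxx big1 // => y; rewrite eq_sym => /negPf ->.
Qed.

Lemma sub_site_subphi n (x : n.-tuple (V + A)%type) (T : {set 'I_n}) i : i \in T ->
  sub_site (subphi n x T) (tnth x i) = subphi n x (T :\ i).
Proof.
move=> iT; apply/ffunP => y; rewrite ffunE !subphiE (big_setD1 i) //= eq_sym.
by rewrite addKn.
Qed.

(** The occupation number of a site counts the labels placed there, so the sum over sites becomes a
    sum over labels. *)
Lemma annih_subphi n (x : n.-tuple (V + A)%type) f T :
  annih f (subphi n x T) = \sum_(i in T) f (subphi n x (T :\ i)).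
Proof.
rewrite /annih; under eq_bigr do rewrite subphiE natr_sum mulr_suml.
rewrite exchange_big /=; apply: eq_bigr => i iT.
rewrite (bigD1 (tnth x i)) //= eqxx mul1r sub_site_subphi // big1 ?addr0 // => y.
by rewrite eq_sym => /negPf ->; rewrite mul0r.
Qed.

(** Each [S] is reached by removing the other [p] labels in any of their [p!] orders. *)
Lemma iter_annih_subphi n (x : n.-tuple (V + A)%type) p f T :
  iter p annih f (subphi n x T) =
  p`!%:R * \sum_(S : {set 'I_n} | (S \subset T) && (#|T| == #|S| + p)%N) f (subphi n x S).
Proof.
elim: p T => [|p IH] T.
  rewrite mul1r (big_pred1 T) // => S; rewrite addn0 /= eqEcard.
  by case: (boolP (S \subset T)) => //= ST; rewrite eqn_leq (subset_leq_card ST) andbT.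
rewrite iterS annih_subphi.
under eq_bigr do rewrite IH.
rewrite -mulr_sumr (exchange_big_dep (fun S : {set 'I_n} =>
    (S \subset T) && (#|T| == #|S| + p.+1)%N)) /=; last first.
  move=> i S iT /andP[]; rewrite subsetD1 => /andP[-> _] /=.
  by rewrite (cardsD1 i T) iT => /eqP->; rewrite add1n addnS.
rewrite factS mulnC natrM -mulrA; congr (_ * _).
rewrite mulr_sumr; apply: eq_bigr => S /andP[ST /eqP cT].
(* For fixed [S], the first label removed is any of the [p.+1] elements of [T :\: S]. *)
rewrite (eq_bigl (mem (T :\: S))) => [|i].
  rewrite sumr_const; have -> : #|mem (T :\: S)| = p.+1.
    by rewrite cardsD (finset.setIidPr ST) cT addKn.
  by rewrite mulr_natl.
rewrite /= !inE subsetD1 ST /=; case: (boolP (i \in S)) => iS; rewrite ?andbF //=.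
case: (boolP (i \in T)) => //= iT; move: cT; rewrite (cardsD1 i T) iT add1n addnS.
by case=> ->; rewrite eqxx.
Qed.

Lemma bin_sub1 (n k : nat) : n%:R * ('C(n.-1, k))%:R = (n%:R - k%:R) * ('C(n, k))%:R :> R.
Proof.
rewrite -natrM mul_bin_down; have [nk|kn] := ltnP n k.
  by rewrite bin_small // muln0 mulr0.
by rewrite natrM natrB.
Qed.

Lemma Fdual_sub (zeta eta : cfg V A) y : (forall i, zeta (inl i) = 0%N) ->
  (eta y)%:R * Fdual R zeta (sub_site eta y) =
  ((eta y)%:R - (zeta y)%:R) * Fdual R zeta eta.
Proof.
move=> z0; case: y => [i|j].
  rewrite z0 subr0; congr (_ * _); apply: eq_bigr => j _.
  by rewrite ffunE subn0.
rewrite /Fdual (bigD1 j) //= [in RHS](bigD1 j) //= !mulrA ffunE eqxx subn1 bin_sub1.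
congr (_ * _); apply: eq_bigr => l /negPf lj.
by rewrite ffunE (inj_eq (@inr_inj V A)) lj subn0.
Qed.

(** At equal mass, [zeta <= eta] at every site forces equality; otherwise some absorbing site has a
    vanishing binomial coefficient. *)
Lemma Fdual_same_massT m (zeta eta : cfg V A) : in_Omega_abs m zeta -> massT eta = m ->
  (eta == zeta)%:R = Fdual R zeta eta.
Proof.
move=> [z0 zm] em; case: (boolP [forall j, (zeta (inr j) <= eta (inr j))%N]).
  move=> /forallP le.
  have : massT zeta = massT eta by rewrite zm em.
  have leif y : true -> (zeta y <= eta y ?= iff (eta y == zeta y))%N.
    move=> _; split; last by rewrite eq_sym.
    by case: y => [i|j] //; rewrite z0.
  move=> /eqP; rewrite (leqif_sum leif) => /forallP E.
  have -> : eta = zeta by apply/ffunP => y; apply/eqP; exact: E.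
  by rewrite eqxx /Fdual big1 // => j _; rewrite binn.
rewrite negb_forall => /existsP[j]; rewrite -ltnNge => lt.
rewrite /Fdual (bigD1 j) //= bin_small // mul0r.
by case: eqP lt => // ->; rewrite ltnn.
Qed.

(** By [Fdual_sub], site [y] contributes the factor [eta y - zeta y]; these sum to the mass
    difference, and successive differences build up [p!]. *)
Lemma iter_annih_indicator m p (zeta eta : cfg V A) :
  in_Omega_abs m zeta -> massT eta = (m + p)%N ->
  iter p annih (fun xi => (xi == zeta)%:R) eta = p`!%:R * Fdual R zeta eta.
Proof.
move=> zO; elim: p eta => [|p IH] eta em.
  by rewrite /= mul1r (Fdual_same_massT m) // em addn0.
have [z0 zm] := zO.
rewrite iterS {1}/Defs.annih.
rewrite (eq_bigr (fun y => p`!%:R * (((eta y)%:R - (zeta y)%:R) * Fdual R zeta eta))).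
  rewrite -mulr_sumr -mulr_suml sumrB -!natr_sum.
  rewrite -/(massT eta) -/(massT zeta) em zm -natrB ?leq_addr // addKn.
  by rewrite factS natrM mulrA (mulrC _%:R).
move=> y _; have [y0|ypos] := posnP (eta y).
  by rewrite -Fdual_sub // y0 !mul0r mulr0.
rewrite IH -?Fdual_sub // 1?mulrCA //.
by have := massT_sub _ _ eta y ypos; rewrite em addnS => -[].
Qed.

End SubconfigurationCounting.

Theorem theorem5p5 (V A : finType) (R : realType) (Lam : pred nat)
  (c : cfgV V -> cfgV V -> R) (r : V -> A -> R)
  (Lam_down : forall k, Lam k.+1 -> Lam k)
  (c_ge0 : forall xi xi', 0 <= c xi xi')
  (c_cons : forall xi xi', c xi xi' != 0 -> mass xi' = mass xi)
  (c_Lam : forall xi xi' : cfgV V, (forall i, Lam (xi i)) -> c xi xi' != 0 ->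
             forall i, Lam (xi' i))
  (r_ge0 : forall i j, 0 <= r i j)
  (consistent : forall (f : cfg V A -> R) (eta : cfg V A), inOmega Lam eta ->
     genLabs c r (annih f) eta = annih (genLabs c r f) eta)
  (n : nat) (x : n.-tuple (V + A)%type)
  (x_Omega : inOmega Lam (phi x))
  (m : nat) (hm1 : (1 <= m)%N) (hm2 : (m <= n - 1)%N)
  (zeta : cfg V A) (hzeta : in_Omega_abs m zeta) :
  Einf c r (Fdual R zeta) (phi x) =
  \sum_(S : {set 'I_n} | #|S| == m) Pinf c r (phi [seq tnth x i | i <- enum S]) zeta.
Proof.
have mn : (m <= n)%N by apply: leq_trans hm2 (leq_subr _ _).
have massx : massT (phi x) = n by rewrite -subphi_setT massT_subphi cardsT card_ord.
pose f0 : cfg V A -> R := fun xi => (xi == zeta)%:R.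
(* The identity for each power of the generator; the exponential series inherit it termwise. *)
have dual k : iter k (genLabs c r) (Fdual R zeta) (phi x) =
    \sum_(S : {set 'I_n} | #|S| == m) iter k (genLabs c r) f0 (subphi V A n x S).
  have p0 : ((n - m)`!%:R : R) != 0 by rewrite pnatr_eq0 -lt0n fact_gt0.
  (* At mass [n], [Fdual R zeta] is the [(n - m)]-fold annihilation of the indicator [f0], divided
     by [(n - m)!]; this factor cancels the one in [iter_annih_subphi]. *)
  rewrite (iter_genLabs_massT _ _ _ _ _ c_cons _ _
    (fun y => (n - m)`!%:R^-1 * iter (n - m) (@annih V A R) f0 y) n) //; last first.
    by move=> eta en; rewrite (iter_annih_indicator _ _ _ m) ?mulKf // subnKC.
  rewrite iter_genLabs_scale (iter_genLabs_annih _ _ _ _ _ Lam) // -subphi_setT.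
  rewrite iter_annih_subphi mulKf //; apply: eq_bigl => S.
  by rewrite finset.subsetT cardsT card_ord /=; apply/eqP/eqP; lia.
(* The limit on the left is obtained from the convergence of each of the finitely many terms on the
   right. *)
apply: cvg_lim => //.
have lims : \sum_(S : {set 'I_n} | #|S| == m) semigroup c r t f0 (subphi V A n x S)
    @[t --> +oo] --> \sum_(S : {set 'I_n} | #|S| == m) Pinf c r (subphi V A n x S) zeta.
  apply: cvg_big => [|S _]; first exact: add_continuous.
  exact: semigroup_lim_cvg.
apply: (cvg_near_eq lims); near=> t.
have t0 : 0 <= t by near: t; exact: nbhs_pinfty_ge.
apply/esym/cvg_lim => //.
have sums : \sum_(S : {set 'I_n} | #|S| == m) \sum_(k < N)
      (t ^+ k / (k`!)%:R * iter k (genLabs c r) f0 (subphi V A n x S)) @[N --> \oo] -->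
    \sum_(S : {set 'I_n} | #|S| == m) semigroup c r t f0 (subphi V A n x S).
  apply: cvg_big => [|S _]; first exact: add_continuous.
  exact: genLabs_exp_cvg.
apply: (cvg_near_eq sums); near=> N.
by rewrite exchange_big /=; apply: eq_bigr => k _; rewrite dual mulr_sumr.
Unshelve. all: end_near. Qed.
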